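(* Let $M$ be a real $n\times r$ matrix with $n>r$, let $A_0$ be an $r\times r$ submatrix of $M$ with $\det(A_0)\ne 0$, and let $\epsilon>0$. Let $A_0,A_1,A_2,\dots$ be the sequence of $r\times r$ submatrices of $M$ generated by the $2$-greedy maximal volume algorithm (described in the context) started from $A_0$ with tolerance $\epsilon$. Then the sequence $\{|\det(A_\ell)|\}$ is increasing and bounded above by $\prod_{i=1}^{r}\|M(:,i)\|$. Therefore the algorithm converges, i.e. it terminates after finitely many iterations.
   Context: $M(:,i)$ denotes the $i$-th column of $M$ and $\|\cdot\|$ the Euclidean norm. The $2$-greedy maximal volume algorithm with input $M$, $A_0$, $\epsilon$ is as follows. Set $l=0$, $B_0=MA_0^{-1}$ (an $n\times r$ matrix), and let $b_{i_1j_1}$ be an entry of $B_0$ of largest modulus. While $|b_{i_1j_1}|>1+\epsilon$, do: (1) replace the $j_1$-th row of the current submatrix $A_l$ by the $i_1$-th row of $M$; (2) let $b_{i_2j_2}$ be an entry of $B_l$ of largest modulus among all entries of $B_l$ not in column $j_1$ (so $j_2\neq j_1$); (3) let $B_l'=\begin{bmatrix} b_{i_1j_1}&b_{i_1j_2}\\ b_{i_2j_1}&b_{i_2j_2}\end{bmatrix}$ (entries of $B_l$); if $|\det(B_l')|>|b_{i_1j_1}|$, also replace the $j_2$-th row of the submatrix by the $i_2$-th row of $M$; (4) call the resulting $r\times r$ matrix $A_{l+1}$, increase $l$ by one, set $B_l=MA_l^{-1}$, and let $b_{i_1j_1}$ be an entry of $B_l$ of largest modulus. When the loop stops, output $A_l$.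 (If $r=1$, steps (2) and (3) are skipped.) *)

(* Defs.v *)
From mathcomp Require Import all_boot all_order all_algebra.
From mathcomp Require Import reals.
Set Implicit Arguments.
Unset Strict Implicit.
Unset Printing Implicit Defensive.

Import Order.TTheory GRing.Theory Num.Theory.

Local Open Scope ring_scope.

Section TwoGreedy.
Variables (R : realType) (n r : nat).
Implicit Types (M B : 'M[R]_(n, r)) (A : 'M[R]_r).

(* The canonical norm of a matrix in MathComp-Analysis is the max norm, not
   the Euclidean one. *)
Definition euclidean_norm (v : 'cV[R]_n) : R :=
  Num.sqrt (\sum_(i < n) v i 0 ^+ 2).

(* Row selections are not required to be increasing: the algorithm replaces
   rows in place, so its iterates list the rows of M in no particular order. *)
Definition is_submatrix M A : Prop :=
  exists2 f : 'I_r -> 'I_n, injective f & A = rowsub f M.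

Definition replace_row M A (j : 'I_r) (i : 'I_n) : 'M[R]_r :=
  \matrix_(k, l) (if k == j then M i l else A k l).

Definition largest_entry B (i1 : 'I_n) (j1 : 'I_r) : Prop :=
  forall i j, `|B i j| <= `|B i1 j1|.

Definition largest_entry_off_col B (j1 : 'I_r) (i2 : 'I_n) (j2 : 'I_r) : Prop :=
  j2 != j1 /\ forall i j, j != j1 -> `|B i j| <= `|B i2 j2|.

Definition coef_mx M A : 'M[R]_(n, r) := M *m invmx A.

Definition loop_condition M (eps : R) A : Prop :=
  exists i1 j1, largest_entry (coef_mx M A) i1 j1 /\
    1 + eps < `|coef_mx M A i1 j1|.

(* The body of the loop is a relation rather than a function because an entry
   of largest modulus need not be unique: every tie-breaking is allowed. *)
Definition two_greedy_step M A A' : Prop :=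
  let B := coef_mx M A in
  exists i1 j1, largest_entry B i1 j1 /\
    let A1 := replace_row M A j1 i1 in
    if r == 1%N then A' = A1 else
    exists i2 j2, largest_entry_off_col B j1 i2 j2 /\
      let B' : 'M[R]_2 :=
        mxsub (tnth [tuple i1; i2]) (tnth [tuple j1; j2]) B in
      A' = if `|B i1 j1| < `|\det B'| then replace_row M A1 j2 i2 else A1.

(* Terms of As after the first one violating the loop condition are
   unconstrained; they are not produced by the algorithm. *)
Definition two_greedy_execution M (eps : R) A0 (As : nat -> 'M[R]_r) : Prop :=
  As 0%N = A0 /\
  forall l, loop_condition M eps (As l) -> two_greedy_step M (As l) (As l.+1).

(* As l is produced by the algorithm, i.e. the first l loop tests succeed. *)
Definition generated M (eps : R) (As : nat -> 'M[R]_r) (l : nat) : Prop :=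
  forall k, (k < l)%N -> loop_condition M eps (As k).

End TwoGreedy.

(* Main.v *)
(** Replacing k rows of A by rows of M multiplies A on the left by
    1 + E (C - E^T), where E collects the replaced basis columns and C the
    chosen rows of B = M A^-1; by Sylvester's identity its determinant is that
    of the k x k submatrix of B at the replaced positions.  Each step thus
    multiplies |det A| by |b_{i1 j1}|, or by |det B'| > |b_{i1 j1}|, hence by at
    least 1 + eps.  Hadamard's inequality bounds |det A|, so geometric growth
    cannot go on forever. *)
Require Import Defs.
From mathcomp Require Import all_boot all_order all_algebra.
From mathcomp Require Import boolp reals.
Import Order.TTheory GRing.Theory Num.Theory.
Local Open Scope ring_scope.

(** Both sides equal [\det P]: a right factor of determinant 1 clears the lower left block of [P] in
    the first half, the upper right block in the second. *)
Lemma det_1DmulC (K : comNzRingType) (m n : nat) (U : 'M[K]_(m, n))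
    (V : 'M[K]_(n, m)) : \det (1%:M + U *m V) = \det (1%:M + V *m U).
Proof.
pose P : 'M[K]_(m + n) := block_mx 1%:M (- U) V 1%:M.
transitivity (\det P).
  pose L : 'M[K]_(m + n) := block_mx 1%:M 0 (- V) 1%:M.
  have L1 : \det L = 1 by rewrite det_lblock !det1 mulr1.
  transitivity (\det P * \det L); last by rewrite L1 mulr1.
  rewrite -det_mulmx mulmx_block.
  rewrite !(mul1mx, mulmx1, mulmx0, add0r, mulNmx, mulmxN).
  by rewrite opprK subrr det_ublock det1 mulr1.
pose L : 'M[K]_(m + n) := block_mx 1%:M U 0 1%:M.
have L1 : \det L = 1 by rewrite det_ublock !det1 mulr1.
transitivity (\det P * \det L); first by rewrite L1 mulr1.
rewrite -det_mulmx mulmx_block.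
rewrite !(mul1mx, mulmx1, mulmx0, addr0, mulNmx, mulmxN).
by rewrite subrr det_lblock det1 mul1r addrC.
Qed.

Lemma det_replace_rows (F : fieldType) (n r k : nat) (M : 'M[F]_(n, r))
    (A A' : 'M[F]_r) (f : 'I_k -> 'I_n) (g : 'I_k -> 'I_r) :
    \det A != 0 -> injective g ->
    (forall a, row (g a) A' = row (f a) M) ->
    (forall j, j \notin codom g -> row j A' = row j A) ->
  \det A' = \det (mxsub f g (M *m invmx A)) * \det A.
Proof.
move=> A_neq0 g_inj A'g A'Ng; set B := M *m invmx A.
have A_unit : A \in unitmx by rewrite unitmxE unitfE.
have BA : B *m A = M by rewrite /B mulmxKV.
pose E : 'M[F]_(r, k) := colsub g 1%:M.
pose S : 'M[F]_(k, r) := rowsub g 1%:M.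
pose D : 'M[F]_(k, r) := rowsub f B - S.
have SE : S *m E = 1%:M.
  rewrite mulmx_colsub mulmx1; apply/matrixP=> a b.
  by rewrite !mxE (inj_eq g_inj).
have DA : D *m A = rowsub f M - rowsub g A.
  by rewrite mulmxBl !mul_rowsub_mx BA mul1mx.
(* Row [g a] of [E] selects row [a] of [D *m A], the new row minus the old one; the rows of [E]
   outside the image of [g] vanish. *)
have A'E : A' = (1%:M + E *m D) *m A.
  rewrite mulmxDl mul1mx -mulmxA DA; apply/row_matrixP=> j.
  rewrite linearD /= row_mul.
  have [/codomP[a ->]|jNg] := boolP (j \in codom g).
    have -> : row (g a) E = delta_mx 0 a.
      by apply/rowP=> b; rewrite !mxE (inj_eq g_inj) eqxx eq_sym.
    by rewrite -rowE linearB /= !row_rowsub A'g addrC subrK.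
  have -> : row j E = 0.
    apply/rowP=> b; rewrite !mxE; case: eqP => // jE.
    by rewrite jE codom_f in jNg.
  by rewrite mul0mx addr0 A'Ng.
(* After the swap, [S *m E = 1] cancels the identity, leaving [rowsub f B *m E]. *)
rewrite A'E det_mulmx det_1DmulC /D mulmxBl SE addrC subrK.
by rewrite mulmx_colsub mulmx1; congr (\det _ * _); apply/matrixP=> a b; rewrite !mxE.
Qed.

Lemma mulmx_tr_eq0 (F : realFieldType) (m n : nat) (A : 'M[F]_(m, n)) :
  A *m A^T = 0 -> A = 0.
Proof.
move=> AAt0; apply/matrixP=> i j; rewrite mxE.
have /matrixP/(_ i i) := AAt0; rewrite !mxE.
under eq_bigr do rewrite mxE -expr2.
move/eqP; rewrite psumr_eq0 => [/allP/(_ j)|k _]; last exact: sqr_ge0.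
by rewrite mem_index_enum sqrf_eq0 => /(_ isT)/eqP.
Qed.

Lemma gram_diag_ge0 (F : realFieldType) (m n : nat) (A : 'M[F]_(m, n)) i :
  0 <= (A *m A^T) i i.
Proof.
by rewrite mxE sumr_ge0 // => j _; rewrite mxE -expr2 sqr_ge0.
Qed.

(** The normal equations [u *m (A *m A^T) = v *m A^T] are solvable even when the rows of [A] are
    dependent, since the row space of [A^T] lies in that of [A *m A^T]. *)
Lemma orthogonal_projection (F : realFieldType) (m n : nat) (v : 'rV[F]_n)
  (A : 'M[F]_(m, n)) : exists u : 'rV_m, (v - u *m A) *m A^T = 0.
Proof.
have /submxP[D AtE] : (A^T <= A *m A^T)%MS.
  rewrite submxE; set K := cokermx _.
  (* With K := cokermx (A *m A^T), the product (A^T K)^T (A^T K) vanishes. *)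
  suff /(congr1 trmx) : (A^T *m K)^T = 0 by rewrite trmxK trmx0 => ->.
  apply: mulmx_tr_eq0.
  rewrite trmxK trmx_mul trmxK -mulmxA (mulmxA A) /K mulmx_coker.
  by rewrite mulmx0.
by exists (v *m D); rewrite mulmxBl -!mulmxA -AtE subrr.
Qed.

(* Subtracting from the first row its projection onto the others leaves the
   Gram determinant unchanged, splits it and decreases the first diagonal
   entry. *)
Lemma gram_det_bounds (F : realFieldType) (m n : nat) (A : 'M[F]_(m, n)) :
  0 <= \det (A *m A^T) <= \prod_i (A *m A^T) i i.
Proof.
elim: m => [|m IH] in A *.
  by rewrite det_mx00 big_ord0 ler01 lexx.
suff bounds : forall (v : 'rV[F]_n) (B : 'M[F]_(m, n)), let C := col_mx v B in
    0 <= \det (C *m C^T) <= \prod_i (C *m C^T) i i.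
  by rewrite -[A](@vsubmxK _ 1 m n); exact: bounds.
move=> v {}A /=.
have [u vuA] := orthogonal_projection _ _ _ v A.
set w := v - u *m A in vuA.
have vE : v = w + u *m A by rewrite subrK.
clearbody w.
have wuA : A *m w^T = 0 by rewrite -[LHS]trmxK trmx_mul trmxK vuA trmx0.
have detE : \det (col_mx v A *m (col_mx v A)^T) =
    (w *m w^T) 0 0 * \det (A *m A^T).
  pose L : 'M[F]_(1 + m) := block_mx 1%:M u 0 1%:M.
  have -> : col_mx v A = L *m col_mx w A.
    by rewrite mul_block_col !mul1mx mul0mx add0r -vE.
  rewrite trmx_mul mulmxA -(mulmxA L) !det_mulmx det_tr.
  rewrite det_ublock !det1 !mul1r mulr1.
  rewrite tr_col_mx mul_col_row vuA wuA det_lblock.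
  by rewrite det_mx11.
have /andP[A_ge0 A_le] := IH A.
rewrite detE mulr_ge0 ?gram_diag_ge0 //= big_split_ord big_ord1 /=.
apply: ler_pM => //; first exact: gram_diag_ge0.
  (* Pythagoras: the squared norm of [v] is that of [w] plus that of [u *m A]. *)
  rewrite tr_col_mx mul_col_row block_mxEul.
  rewrite vE linearD /= mulmxDl !mulmxDr trmx_mul -!mulmxA wuA mulmx0 add0r.
  rewrite (mulmxA w) vuA mul0mx addr0 mulmxA -trmx_mul [leRHS]mxE lerDl.
  exact: gram_diag_ge0.
apply: le_trans A_le _; apply: ler_prod => i _; rewrite gram_diag_ge0 /=.
by rewrite tr_col_mx mul_col_row block_mxEdr.
Qed.

Lemma hadamard_submatrix (R : realType) (n r : nat) (M : 'M[R]_(n, r)) A :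
  is_submatrix M A -> `|\det A| <= \prod_(i < r) euclidean_norm (col i M).
Proof.
case=> f f_inj ->.
have norm_ge0 : 0 <= \prod_(i < r) euclidean_norm (col i M).
  by apply: prodr_ge0 => i _; exact: sqrtr_ge0.
rewrite -ler_sqr ?nnegrE // real_normK ?num_real // -prodrXl.
set D := rowsub f M.
have -> : \det D ^+ 2 = \det (D^T *m D^T^T).
  by rewrite trmxK det_mulmx det_tr expr2.
(* Transposing turns the Gram diagonal into squared norms of columns. *)
have /andP[_ /le_trans] := gram_det_bounds _ _ _ D^T; apply.
apply: ler_prod => j _; rewrite gram_diag_ge0 /= sqr_sqrtr; last first.
  by apply: sumr_ge0 => i _; exact: sqr_ge0.
rewrite mxE.
under eq_bigr do rewrite !mxE -expr2.
rewrite [leRHS](eq_bigr (fun i => M i j ^+ 2)); last by move=> i _; rewrite mxE.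
(* As [f] is injective, the sum over selected rows is a subsum of the squared norm of the full
   column. *)
rewrite -(big_imset (A := 'I_r) (fun i => M i j ^+ 2)); last by move=> ? ? _ _ /f_inj.
rewrite [leRHS](bigID [in f @: 'I_r]) /= lerDl.
by apply: sumr_ge0 => i _; exact: sqr_ge0.
Qed.

Lemma row_replace_row (R : realType) (n r : nat) (M : 'M[R]_(n, r)) A j i k :
  row k (replace_row M A j i) = if k == j then row i M else row k A.
Proof. by apply/rowP=> l; case: ifP => kj; rewrite !mxE kj. Qed.

Lemma det_replace_row (R : realType) (n r : nat) (M : 'M[R]_(n, r)) A j i :
  \det A != 0 -> \det (replace_row M A j i) = coef_mx M A i j * \det A.
Proof.
move=> A_neq0; rewrite (@det_replace_rows _ n r 1 M A _ (fun=> i) (fun=> j)) //.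
- by rewrite det_mx11 mxE.
- by move=> a b _; rewrite !ord1.
- by move=> a; rewrite row_replace_row eqxx.
move=> k kNj; rewrite row_replace_row; case: eqP => // kj.
by case/negP: kNj; apply/codomP; exists 0.
Qed.

Lemma det_replace_row2 (R : realType) (n r : nat) (M : 'M[R]_(n, r)) A
    (j1 j2 : 'I_r) (i1 i2 : 'I_n) : \det A != 0 -> j2 != j1 ->
  \det (replace_row M (replace_row M A j1 i1) j2 i2) =
  \det (mxsub (tnth [tuple i1; i2]) (tnth [tuple j1; j2]) (coef_mx M A))
    * \det A.
Proof.
move=> A_neq0 j2Nj1; apply: det_replace_rows => //.
- by apply/tuple_uniqP; rewrite /= inE eq_sym j2Nj1.
- move=> [[|[|//]] lt_a]; rewrite !(tnth_nth j1, tnth_nth i1) /=.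
    by rewrite !row_replace_row eq_sym (negbTE j2Nj1) eqxx.
  by rewrite row_replace_row eqxx.
move=> k; rewrite !row_replace_row => kNg.
have [kj|_] := eqVneq k j2.
  by case/codomP: kNg; exists ord_max; rewrite (tnth_nth j1).
by have [kj|//] := eqVneq k j1; case/codomP: kNg; exists ord0.
Qed.

(** A row selected twice would make the determinant vanish. Thus distinctness of the rows need not
    be tracked through the replacements. *)
Lemma rowsub_is_submatrix (R : realType) (n r : nat) (M : 'M[R]_(n, r)) f :
  \det (rowsub f M) != 0 -> is_submatrix M (rowsub f M).
Proof.
move=> det_neq0; exists f => // a b fab; apply/eqP; apply: contraNT det_neq0.
move=> aNb; apply/eqP/(determinant_alternate aNb) => k.
by rewrite !mxE fab.
Qed.

Lemma replace_row_submatrix (R : realType) (n r : nat) (M : 'M[R]_(n, r)) A j i :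
  is_submatrix M A -> \det (replace_row M A j i) != 0 ->
  is_submatrix M (replace_row M A j i).
Proof.
case=> f _ ->; set A' := replace_row _ _ _ _.
suff -> : A' = rowsub (fun k => if k == j then i else f k) M.
  exact: rowsub_is_submatrix.
by apply/matrixP=> k l; rewrite !mxE; case: ifP.
Qed.

Lemma two_greedy_step_grows (R : realType) (n r : nat) (M : 'M[R]_(n, r))
    (A A' : 'M[R]_r) (eps : R) :
    0 < eps -> is_submatrix M A -> \det A != 0 ->
    loop_condition M eps A -> two_greedy_step M A A' ->
  is_submatrix M A' /\ (1 + eps) * `|\det A| <= `|\det A'|.
Proof.
move=> eps_gt0 A_sub A_neq0 [i [j [_ b_gt]]] [i1 [j1 [b_max]]] /=.
(* The loop test and the step may pick different largest entries; maximality carries the bound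
   over. *)
have {i j b_gt b_max} b_gt := lt_le_trans b_gt (b_max i j).
have b_gt0 : 0 < `|coef_mx M A i1 j1|.
  by apply: lt_trans b_gt; rewrite addr_gt0.
set A1 := replace_row M A j1 i1.
have detA1 : \det A1 = coef_mx M A i1 j1 * \det A by exact: det_replace_row.
have A1_neq0 : \det A1 != 0 by rewrite detA1 mulf_neq0 // -normr_gt0.
have A1_sub : is_submatrix M A1 by exact: replace_row_submatrix.
have A1_grows : (1 + eps) * `|\det A| <= `|\det A1|.
  by rewrite detA1 normrM ler_pM2r ?normr_gt0 // ltW.
case: ifP => _ => [-> //|[i2 [j2 [[j2Nj1 _]]]]].
case: ifP => [det_gt|_] -> //.
have detA2 := det_replace_row2 _ _ _ M A j1 j2 i1 i2 A_neq0 j2Nj1.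
split.
  apply: replace_row_submatrix => //.
  by rewrite detA2 mulf_neq0 // -normr_gt0 (lt_trans b_gt0).
apply: le_trans A1_grows _.
by rewrite detA1 detA2 !normrM ler_pM2r ?normr_gt0 // ltW.
Qed.

Lemma bernoulli_le (F : realFieldType) (x : F) (k : nat) :
  0 <= x -> 1 + x *+ k <= (1 + x) ^+ k.
Proof.
move=> x_ge0; elim: k => [|k IH]; first by rewrite mulr0n addr0 expr0.
rewrite exprS; apply: le_trans (ler_wpM2l _ IH); last by rewrite addr_ge0.
rewrite mulrDl mul1r mulrDr mulr1 mulrS addrA addrAC -!addrA !lerD2l.
by rewrite addrC lerDr mulr_ge0 ?mulrn_wge0.
Qed.

Lemma geometric_unbounded (R : realType) (x a c : R) :
  0 < x -> 0 < a -> exists k, c < (1 + x) ^+ k * a.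
Proof.
(* This [k] exceeds [c / (x * a)], so the linear term in Bernoulli's inequality, times [a], already
   exceeds [c]. *)
move=> x_gt0 a_gt0; pose k := Num.bound `|c / (x * a)|; exists k.
have c_lt : c < (x * a) *+ k.
  rewrite -mulr_natl -ltr_pdivrMr ?mulr_gt0 //.
  exact: le_lt_trans (ler_norm _) (archi_boundP (normr_ge0 _)).
apply: lt_le_trans c_lt _; rewrite -mulrnAl ler_pM2r //.
apply: le_trans (bernoulli_le _ _ k (ltW x_gt0)); exact: ler_wpDl.
Qed.

Theorem theorem6 (R : realType) (n r : nat) (M : 'M[R]_(n, r))
    (A0 : 'M[R]_r) (eps : R) (As : nat -> 'M[R]_r)
    (n_gt_r : (r < n)%N)
    (A0_sub : is_submatrix M A0)
    (A0_det : \det A0 != 0)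
    (eps_gt0 : 0 < eps)
    (As_run : two_greedy_execution M eps A0 As) :
  [/\ forall l, generated M eps As l.+1 -> `|\det (As l)| < `|\det (As l.+1)|,
      forall l, generated M eps As l ->
        `|\det (As l)| <= \prod_(i < r) euclidean_norm (col i M)
    & exists L, generated M eps As L /\ ~ loop_condition M eps (As L)].
Proof.
have [As0 As_step] := As_run.
have genS l : generated M eps As l.+1 ->
    generated M eps As l /\ loop_condition M eps (As l).
  by move=> gen; split=> [k kl|]; apply: gen; rewrite // ltnW.
(* Being a submatrix serves Hadamard's bound, the nonzero determinant keeps [coef_mx] meaningful,
   and the geometric bound forces termination. *)
have invariant l : generated M eps As l -> [/\ is_submatrix M (As l),
    \det (As l) != 0 & (1 + eps) ^+ l * `|\det A0| <= `|\det (As l)|].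
  elim: l => [_|l IH /genS[/IH[sub neq0 large] loop]].
    by rewrite As0 expr0 mul1r.
  have [sub' grows] := two_greedy_step_grows _ _ _ _ _ _ _
    eps_gt0 sub neq0 loop (As_step _ loop).
  split=> //.
    rewrite -normr_gt0; apply: lt_le_trans grows.
    by rewrite mulr_gt0 ?normr_gt0 ?addr_gt0.
  apply: le_trans grows; rewrite exprS -mulrA ler_pM2l //; exact: addr_gt0.
have bounded l : generated M eps As l ->
    `|\det (As l)| <= \prod_(i < r) euclidean_norm (col i M).
  by case/invariant=> sub _ _; exact: hadamard_submatrix.
split=> //.
  move=> l /genS[/invariant[sub neq0 _] loop].
  have [_ grows] := two_greedy_step_grows _ _ _ _ _ _ _
    eps_gt0 sub neq0 loop (As_step _ loop).
  by apply: lt_le_trans grows; rewrite ltr_pMl ?normr_gt0 // ltrDl.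
(* If no generated iterate fails the loop test, then all indices are generated, and geometric growth
   breaks Hadamard's bound. *)
apply: contrapT => no_stop.
have gen l : generated M eps As l.
  elim: l => [//|l IH] k; rewrite ltnS leq_eqVlt => /predU1P[->|/IH//].
  by apply: contrapT => stop; apply: no_stop; exists l.
have A0_gt0 : 0 < `|\det A0| by rewrite normr_gt0.
have [k] := geometric_unbounded _ eps _
  (\prod_(i < r) euclidean_norm (col i M)) eps_gt0 A0_gt0.
have [_ _ large] := invariant k (gen k).
by rewrite ltNge (le_trans large) // bounded.
Qed.
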